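(* Let $d\ge 0$ and let $G_d=C_3^d\rtimes C_2$, where $C_2$ acts on the elementary abelian group $C_3^d$ by inverting every element. The minimal synthetic buildings for $G_d$ at the prime $p=2$ are, up to isomorphism of $G_d$-simplicial complexes, precisely the discrete sets of points $G_d/(H\rtimes C_2)$ where $H\le C_3^d$ is a subgroup. There are exactly $d+1$ homotopically distinct minimal synthetic buildings (that is, they fall into exactly $d+1$ ordinary homotopy types).
   Context: A $G$-simplicial complex is a finite (possibly empty) simplicial complex $\Delta$ with a simplicial action of the finite group $G$ such that the setwise stabilizer of each simplex fixes that simplex pointwise. For $H\le G$, $\Delta^H$ denotes the fixed point subcomplex. Contractible spaces are non-empty. A $G$-simplicial complex $\Delta$ is a synthetic building for $G$ at the prime $p$ if (1) $\Delta^P$ is $N_G(P)$-equivariantly contractible for every non-identity $p$-subgroup $P\le G$, and (2) the stabilizer of every simplex has order divisible by $p$. A synthetic building is minimal if it has no proper $G$-invariant subcomplex that is also a synthetic building for $G$ at $p$. A transitive $G$-set $G/L$ is regarded as a $0$-dimensional $G$-simplicial complex. *)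

(* Defs.v *)
From HB Require Import structures.
From mathcomp Require Import all_boot all_order all_algebra all_fingroup.
From mathcomp Require Import all_solvable.
From mathcomp Require Import boolp classical_sets functions reals topology.
From mathcomp Require Import normedtype.

Set Implicit Arguments.
Unset Strict Implicit.
Unset Printing Implicit Defensive.

Import Order.TTheory GRing.Theory Num.Theory numFieldNormedType.Exports.

Local Open Scope ring_scope.

Section Homotopy.
Variables (R : realType) (T U : topologicalType).
Local Open Scope classical_set_scope.

Definition homotopic (A : set T) (B : set U) (f g : T -> U) : Prop :=
  exists h : T * R -> U,
    [/\ {within A `*` `[0, 1], continuous h},
        set_fun (A `*` `[0, 1]) B h,
        forall x, A x -> h (x, 0) = f x
      & forall x, A x -> h (x, 1) = g x].

End Homotopy.

Arguments homotopic R {T U} A B f g.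

Section HomotopyEquivalence.
Variables (R : realType) (T U : topologicalType).
Local Open Scope classical_set_scope.

Definition homotopy_equivalent (A : set T) (B : set U) : Prop :=
  exists (f : T -> U) (g : U -> T),
    [/\ {within A, continuous f} /\ set_fun A B f,
        {within B, continuous g} /\ set_fun B A g,
        homotopic R A A (g \o f) id
      & homotopic R B B (f \o g) id].

End HomotopyEquivalence.

Section EquivariantContractibility.
Variables (R : realType) (gT : finGroupType) (T : topologicalType).
Local Open Scope classical_set_scope.

(* The identity of A is N-equivariantly homotopic to a constant map; taking
   time 1 in the equivariance condition, the point x0 is fixed by N. *)
Definition equivariantly_contractible
    (N : {set gT}) (act : T -> gT -> T) (A : set T) : Prop :=
  exists2 x0 : T, A x0 &
  exists h : T * R -> T,
    [/\ {within A `*` `[0, 1], continuous h},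
        set_fun (A `*` `[0, 1]) A h,
        forall x, A x -> h (x, 0) = x,
        forall x, A x -> h (x, 1) = x0
      & forall a x t, a \in N -> A x -> `[0, 1] t ->
          h (act x a, t) = act (h (x, t)) a].

End EquivariantContractibility.

(* A face is identified with its nonempty set of vertices; elements of V need
   not be vertices, so that subcomplexes live over the same V. *)
Definition is_complex (V : finType) (D : {set {set V}}) : Prop :=
  finset.set0 \notin D /\
  forall s t : {set V}, s \in D -> t != finset.set0 -> t \subset s -> t \in D.

(* Points are given by barycentric coordinates. *)
Definition realization (R : realType) (V : finType) (D : {set {set V}}) :
    set {ptws V -> R} :=
  [set x : {ptws V -> R} | [/\ forall v : V, 0 <= x v, \sum_(v : V) x v = 1
                             & finset (fun v : V => x v != 0) \in D]]%classic.

Arguments realization R {V} D.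

Section EquivariantComplexes.
Variables (gT : finGroupType) (G : {group gT}).

(* Actions are right actions, the convention of the library: a left action
   a.v is read as v.a^-1, and accordingly G/L as the set of cosets L :* a. *)
Record gcomplex := GComplex {
  vertex : finType;
  gact : action G vertex;
  faces : {set {set vertex}};
  facesP : is_complex faces;
  vertex_face : forall v : vertex, [set v]%SET \in faces;
  gact_faces : [acts G, on faces | gact^*];
  gact_regular : forall s, s \in faces -> 'N_G(s | gact)%g \subset 'C_G(s | gact)%g
}.

Section Subcomplexes.
Variables (V : finType) (to : action G V).
Implicit Type D : {set {set V}}.

(* By gact_regular, a point fixed by P lies in a simplex fixed pointwise by P. *)
Definition fixed_faces (P : {set gT}) D : {set {set V}} :=
  [set s in D | s \subset 'Fix_to(P)%g]%SET.

Definition realization_act (R : realType) (x : {ptws V -> R}) (a : gT) :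
    {ptws V -> R} :=
  fun v => x (to v a^-1%g).

Definition synthetic_building (R : realType) (p : nat) D : Prop :=
  (forall P : {group gT}, P \subset G -> (p.-group P)%g -> P :!=: 1%g ->
     equivariantly_contractible R 'N_G(P)%g (@realization_act R)
       (realization R (fixed_faces P D)))
  /\ (forall s, s \in D -> (p %| #|'N_G(s | to)%g|)%N).

End Subcomplexes.
Arguments synthetic_building {V} to R p D.

Definition minimal_synthetic_building (R : realType) (p : nat) (X : gcomplex) :
    Prop :=
  synthetic_building (gact X) R p (faces X) /\
  forall D : {set {set vertex X}},
    is_complex D -> [acts G, on D | (gact X)^*] -> D \proper faces X ->
    ~ synthetic_building (gact X) R p D.

Definition gcomplex_iso (X Y : gcomplex) : Prop :=
  exists f : vertex X -> vertex Y,
    [/\ bijective f,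
        forall s : {set vertex X}, (f @: s \in faces Y) = (s \in faces X)
      & forall (v : vertex X) a, a \in G -> f (gact X v a) = gact Y (f v) a].

Definition same_homotopy_type (R : realType) (X Y : gcomplex) : Prop :=
  @homotopy_equivalent R {ptws vertex X -> R} {ptws vertex Y -> R}
    (realization R (faces X)) (realization R (faces Y)).

Section Discrete.
Variables (V : finType) (to : action G V).

Definition discrete_faces : {set {set V}} := [set [set v]%SET | v : V]%SET.

Lemma discrete_facesP : is_complex discrete_faces.
Proof.
split=> [|_ t /imsetP[v _ ->]].
  by apply/imsetP=> -[v _ /setP/(_ v)]; rewrite !inE eqxx.
rewrite finset.subset1 => /negPf t0; rewrite t0 orbF => /eqP ->.
exact: imset_f.
Qed.

Lemma discrete_vertex (v : V) : [set v]%SET \in discrete_faces.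
Proof. exact: imset_f. Qed.

Lemma discrete_acts : [acts G, on discrete_faces | to^*].
Proof.
apply/fintype.subsetP=> a Ga; rewrite !inE Ga.
apply/fintype.subsetP=> _ /imsetP[v _ ->].
by rewrite inE /= /setact imset_set1 discrete_vertex.
Qed.

Lemma discrete_regular s :
  s \in discrete_faces -> 'N_G(s | to)%g \subset 'C_G(s | to)%g.
Proof.
case/imsetP=> v _ ->; apply/fintype.subsetP=> a; rewrite !inE.
by case/and3P=> Ga _; rewrite Ga !finset.sub1set !inE.
Qed.

Definition discrete_gcomplex : gcomplex :=
  GComplex discrete_facesP discrete_vertex discrete_acts discrete_regular.

End Discrete.

Section Cosets.
Variable L : {group gT}.

Definition coset_point : finType := {C : {set gT} | C \in rcosets L G}.

Lemma coset_point_acts :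
  G \subset subact_dom (fun C : {set gT} => C \in rcosets L G) 'Rs.
Proof.
have -> : subact_dom (fun C : {set gT} => C \in rcosets L G) 'Rs
          = 'N(rcosets L G | 'Rs)%g.
  by congr ('N(_ | 'Rs))%g; apply/setP=> C; rewrite inE.
exact: actsRs_rcosets.
Qed.

Definition coset_act : action G coset_point :=
  ('Rs^? \ coset_point_acts)%act.

Definition coset_gcomplex : gcomplex := discrete_gcomplex coset_act.

End Cosets.
End EquivariantComplexes.

(* Main.v *)
(** The involutions of G are all conjugate to the one in C, and C fixes at most
    one vertex in each G-orbit. Hence the orbit of any vertex
    v fixed by C, as a discrete subcomplex, is already a synthetic building: the
    fixed points of a nontrivial 2-subgroup in it form a single point. Every
    synthetic building has such a v, because the realization of the fixed points
    of C is nonempty, so the minimal ones are these transitive orbits G/L with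
    L = Stab(v) containing C, and L = (L ∩ A) ⋊ C by Dedekind's law. Paths in the
    realization of a discrete complex are constant, so a homotopy equivalence
    between discrete complexes is a bijection of points; the homotopy type is
    determined by |G/L| = 3^(d-i), where |L ∩ A| = 3^i. *)

Require Import Defs.
From HB Require Import structures.
From mathcomp Require Import all_boot all_order all_algebra all_fingroup.
From mathcomp Require Import all_solvable.
From mathcomp Require Import boolp classical_sets functions reals topology.
From mathcomp Require Import normedtype.

Set Implicit Arguments.
Unset Strict Implicit.
Unset Printing Implicit Defensive.

Import Order.TTheory GRing.Theory Num.Theory numFieldNormedType.Exports.

(** * Coordinatewise convergence in spaces of functions *)

Section PointwiseTopology.
Local Open Scope classical_set_scope.

(** The pointwise topology is the supremum of the initial topologies of the evaluations, so a filter
    can be tested on each evaluation separately. *)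
Lemma ptws_cvg (I : Type) (T : topologicalType) (F : set_system {ptws I -> T})
    (f : {ptws I -> T}) : Filter F ->
  (forall i, (fun g => g i) @ F --> f i) -> F --> f.
Proof.
move=> FF Ff; pose proj_topology i :=
  Topological.class (initial_topology (fun f : I -> T => f i)).
refine (iffRL (@cvg_sup (I -> T) I proj_topology F f FF) _) => i U [_ [[B oB <-] Bxk] BU].
have fB : nbhs (f i) B by exact: open_nbhs_nbhs.
by apply: (@filterS _ F FF _ _ _ (Ff i B fB)); exact: BU.
Qed.

Lemma reindex_continuous (R : topologicalType) (V : eqType) (W : Type) (k : W -> V) :
  continuous (fun x : {ptws V -> R} => (fun w => x (k w)) : {ptws W -> R}).
Proof.
move=> x.
have x_filter := fmap_filter (fun (y : {ptws V -> R}) w => y (k w)) (nbhs_filter x).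
apply: (ptws_cvg x_filter) => w.
exact: (@proj_continuous V (fun=> R) (k w) x).
Qed.

End PointwiseTopology.

(** * Realizations of discrete complexes and their homotopy types *)

Section DiscreteRealization.
Variable R : realType.
Local Open Scope ring_scope.
Local Open Scope classical_set_scope.
Implicit Types V W : finType.

Definition vertex_point V (v : V) : {ptws V -> R} := fun w => (w == v)%:R.

Lemma realization_vertex_point V (D : {set {set V}}) (v : V) :
  [set v]%SET \in D -> realization R D (vertex_point v).
Proof.
move=> Dv; split=> [w||]; first exact: ler0n.
  rewrite (bigD1 v) //= /vertex_point eqxx big1 ?addr0 // => w /negPf ->//.
suff -> : finset (fun w : V => vertex_point v w != 0) = [set v]%SET by [].
by apply/setP=> w; rewrite !inE /vertex_point pnatr_eq0 eqb0 negbK.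
Qed.

(** The support of [x] is a single vertex, and since the coordinates sum to 1 the only nonzero one
    is 1. *)
Lemma discrete_realization V (D : {set {set V}}) (x : {ptws V -> R}) :
  D \subset discrete_faces V -> realization R D x ->
  exists2 v, [set v]%SET \in D & x = vertex_point v.
Proof.
move=> sD [x_ge0 x_sum Dx].
have /imsetP[v _ x_supp] := fintype.subsetP sD _ Dx.
have x_v w : (x w != 0) = (w == v) by move/setP/(_ w): x_supp; rewrite !inE.
exists v; first by rewrite -x_supp.
have x0 w : w != v -> x w = 0 by rewrite -x_v negbK => /eqP.
apply: funext => w; rewrite /vertex_point; have [->|/x0//] := eqVneq w v.
by rewrite -x_sum (bigD1 v) //= big1 ?addr0.
Qed.

(** Along the path each barycentric coordinate takes only the values 0 and 1, so by the intermediate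
    value theorem it cannot change. *)
Lemma discrete_path_constant V (D : {set {set V}}) (c : R -> {ptws V -> R}) :
  D \subset discrete_faces V ->
  {within `[0, 1], continuous c} -> set_fun `[0, 1] (realization R D) c ->
  c 0 = c 1.
Proof.
move=> sD c_cont c_real.
have c_vertex t : `[0, 1] t -> exists v, c t = vertex_point v.
  by move=> /c_real /(discrete_realization sD)[v _ ->]; exists v.
have [v c0] : exists v, c 0 = vertex_point v.
  by apply: c_vertex; rewrite /= in_itv /= lexx ler01.
have [w c1] : exists w, c 1 = vertex_point w.
  by apply: c_vertex; rewrite /= in_itv /= lexx ler01.
have [vw|vw] := eqVneq v w; first by rewrite c0 c1 vw.
have cv_cont : {within `[0, 1], continuous (fun t => c t v)}.
  apply/subspace_continuousP => t t01.
  move/subspace_continuousP/(_ t t01): c_cont.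
  by move=> c_cvg; exact: (cvg_comp _ _ c_cvg (@proj_continuous V (fun=> R) v _)).
(* The coordinate at [v] runs from 1 to 0, so it takes the value 1/2, which no vertex point
   allows. *)
have [|t t01 /eqP] := IVT (v := 2^-1) ler01 cv_cont.
  rewrite c0 c1 /vertex_point eqxx (negPf vw) min_r ?ler01 //.
  by rewrite max_l ?ler01 // invr_ge0 ler0n invf_le1 ?ltr0n // ler1n.
have [u ->] := c_vertex _ t01; rewrite /vertex_point.
case: (v == u); last by rewrite eq_sym invr_eq0 pnatr_eq0.
by rewrite eq_sym invr_eq1 (eqr_nat _ 2 1).
Qed.

(** The track of [x] under the homotopy is a path from [f x] to [g x] in a discrete realization. *)
Lemma discrete_homotopic_eq V (D : {set {set V}}) (T : topologicalType) (A : set T)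
    (f g : T -> {ptws V -> R}) x :
  D \subset discrete_faces V -> homotopic R A (realization R D) f g ->
  A x -> f x = g x.
Proof.
move=> sD [h [h_cont h_real h0 h1]] Ax.
rewrite -h0 // -h1 //; apply: (discrete_path_constant (c := fun t => h (x, t)) sD).
  apply/subspace_continuousP => t t01.
  move/subspace_continuousP/(_ (x, t) (conj Ax t01)): h_cont.
  apply: cvg_comp => U [[U1 U2] [/= U1x U2t] U12].
  (* Only the time factor of the product neighbourhood matters, as [x] stays in the other factor
     [U1]. *)
  apply: filterS U2t => s U2s s01.
  apply: (U12 (x, s)); last by split.
  by split=> //=; exact: nbhs_singleton.
by move=> t t01; exact: h_real.
Qed.

(** Here [f] sends vertices to vertices, and [g \o f], being homotopic to the identity, equals it on
    vertices; hence [f] is injective there. Exchanging the two complexes will give equality of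
    cardinals. *)
Lemma discrete_homotopy_card V W (D : {set {set V}}) (E : {set {set W}}) :
  D = discrete_faces V -> E = discrete_faces W ->
  @homotopy_equivalent R {ptws V -> R} {ptws W -> R}
    (realization R D) (realization R E) -> (#|V| <= #|W|)%N.
Proof.
move=> DV EW [f [g [[_ f_real] _ gf _]]].
have sD : D \subset discrete_faces V by rewrite DV.
have sE : E \subset discrete_faces W by rewrite EW.
have real_v v : realization R D (vertex_point v).
  by apply: realization_vertex_point; rewrite DV discrete_vertex.
have f_vertex v : exists w, f (vertex_point v) = vertex_point w.
  by have [w _ ->] := discrete_realization sE (f_real _ (real_v v)); exists w.
have [k kP] := choice f_vertex.
apply: (@leq_card _ _ k) => u v kuv.
have : @vertex_point V u = vertex_point v.
  rewrite -[LHS](discrete_homotopic_eq sD gf (real_v u)).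
  rewrite -[RHS](discrete_homotopic_eq sD gf (real_v v)) /=.
  by rewrite !kP kuv.
by move/(congr1 (@^~ v))/eqP; rewrite /vertex_point eqxx eqr_nat eqb1 => /eqP.
Qed.

Lemma homotopic_eq (T : topologicalType) (A : set T) (f : T -> T) :
  (forall x, A x -> f x = x) -> homotopic R A A f id.
Proof.
move=> fA; exists fst; split=> //.
- by apply: continuous_subspaceT => x; exact: cvg_fst.
- by move=> [x t] [].
- by move=> x /fA ->.
Qed.

(** A bijection of vertices relabels barycentric coordinates, which gives mutually inverse
    continuous maps. *)
Lemma discrete_homotopy_equivalent V W (D : {set {set V}}) (E : {set {set W}}) :
  D = discrete_faces V -> E = discrete_faces W -> #|V| = #|W| ->
  @homotopy_equivalent R {ptws V -> R} {ptws W -> R}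
    (realization R D) (realization R E).
Proof.
move=> DV EW eqVW.
pose k v : W := enum_val (cast_ord eqVW (enum_rank v)).
pose k' w : V := enum_val (cast_ord (esym eqVW) (enum_rank w)).
have kK : cancel k k' by move=> v; rewrite /k' enum_valK cast_ordK enum_rankK.
have k'K : cancel k' k by move=> w; rewrite /k enum_valK cast_ordKV enum_rankK.
have real_reindex (V1 W1 : finType) (D1 : {set {set V1}}) (E1 : {set {set W1}})
    (f : V1 -> W1) (g : W1 -> V1) :
    D1 = discrete_faces V1 -> E1 = discrete_faces W1 -> cancel f g -> cancel g f ->
    set_fun (realization R D1) (realization R E1)
      (fun x : {ptws V1 -> R} => (fun w => x (g w)) : {ptws W1 -> R}).
  move=> D1V E1W fK gK x Dx.
  have [|v _ ->] := discrete_realization _ Dx; first by rewrite D1V.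
  have -> : (fun w => vertex_point v (g w)) = vertex_point (f v).
    apply: funext => w; rewrite /vertex_point; congr (_%:R).
    by rewrite -(can_eq gK) fK.
  by apply: realization_vertex_point; rewrite E1W discrete_vertex.
exists (fun x w => x (k' w)), (fun y v => y (k v)); split.
- split; last exact: (real_reindex _ _ _ _ k k').
  exact/continuous_subspaceT/reindex_continuous.
- split; last exact: (real_reindex _ _ _ _ k' k).
  exact/continuous_subspaceT/reindex_continuous.
- by apply: homotopic_eq => x _; apply: funext => v /=; rewrite kK.
- by apply: homotopic_eq => y _; apply: funext => w /=; rewrite k'K.
Qed.

Lemma homotopy_equivalent_sym (T U : topologicalType) (A : set T) (B : set U) :
  homotopy_equivalent R A B -> homotopy_equivalent R B A.
Proof. by case=> f [g [? ? ? ?]]; exists g, f. Qed.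

(** The realization is one point, so the homotopy constant in time serves. *)
Lemma vertex_equivariantly_contractible (gT : finGroupType) V
    (N : {set gT}) act (D : {set {set V}}) v :
  D = [set [set v]%SET]%SET ->
  equivariantly_contractible R N act (realization R D).
Proof.
move=> Dv.
have sD : D \subset discrete_faces V by rewrite Dv finset.sub1set discrete_vertex.
have xv x : realization R D x -> x = vertex_point v.
  by case/(discrete_realization sD) => w; rewrite Dv inE => /eqP/set1_inj ->.
exists (vertex_point v); first by apply: realization_vertex_point; rewrite Dv set11.
exists fst; split=> //.
- by apply: continuous_subspaceT => x; exact: cvg_fst.
- by move=> [x t] [].
Qed.

End DiscreteRealization.

(* The projection [gact] of [gcomplex] is shadowed by MathComp's [gact] for
   group actions. *)
Local Notation gact := Defs.gact.

(** * The orbit of a vertex as an invariant discrete subcomplex *)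

Section OrbitSubcomplex.
Local Open Scope group_scope.
Variables (gT : finGroupType) (G : {group gT}) (V : finType) (to : action G V).
Implicit Types (v w : V) (D : {set {set V}}).

Definition orbit_faces v : {set {set V}} := [set [set w] | w in orbit to G v].

Lemma orbit_faces1 v w : ([set w] \in orbit_faces v) = (w \in orbit to G v).
Proof. exact: (mem_imset _ _ set1_inj). Qed.

Lemma orbit_facesP v : is_complex (orbit_faces v).
Proof.
split=> [|_ t /imsetP[w vw ->]].
  by apply/imsetP=> -[w _ /setP/(_ w)]; rewrite !inE eqxx.
rewrite finset.subset1 => /negPf t0; rewrite t0 orbF => /eqP ->.
exact: imset_f.
Qed.

Lemma orbit_faces_acts v : [acts G, on orbit_faces v | to^*].
Proof.
apply/fintype.subsetP=> a Ga; rewrite !inE Ga.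
apply/fintype.subsetP=> _ /imsetP[w vw ->].
by rewrite inE /= /setact imset_set1 orbit_faces1 orbit_actr_in.
Qed.

Lemma acts_orbit_faces_sub D v :
  [acts G, on D | to^*] -> [set v] \in D -> orbit_faces v \subset D.
Proof.
move=> actsD Dv; apply/fintype.subsetP=> _ /imsetP[_ /orbitP[a Ga <-] ->].
by have := acts_act actsD Ga [set v]; rewrite /= /setact imset_set1 Dv.
Qed.

(** The stabilizer of the translate of [v] by [a] is the conjugate by [a] of the stabilizer of
    [v]. *)
Lemma afix_conj v a (P : {group gT}) :
  P \subset G -> a \in G -> (to v a \in 'Fix_to(P :^ a)) = (v \in 'Fix_to(P)).
Proof.
move=> sPG Ga; rewrite -!finset.sub1set -!astabCin ?(conj_subG Ga) //.
by rewrite astab1_act_in // conjSg.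
Qed.

(** Contractibility includes nonemptiness: the face is the support of the point to which the fixed
    points of [P] contract. *)
Lemma synthetic_building_fixed_face (R : realType) p D (P : {group gT}) :
  synthetic_building to R p D -> P \subset G -> p.-group P -> P :!=: 1 ->
  exists2 s, s \in D & s \subset 'Fix_to(P).
Proof.
case=> contr _ sPG pP ntP; have [x [_ _ Dx] _] := contr P sPG pP ntP.
by move: Dx; rewrite inE => /andP[Ds sP]; exists (finset (fun v => x v != 0%R)).
Qed.

End OrbitSubcomplex.

Lemma discrete_facesE (V : finType) (s : {set V}) :
  (s \in discrete_faces V) = (#|s| == 1).
Proof.
by apply/imsetP/cards1P => [[v _ ->]|[v ->]]; exists v.
Qed.

(** * Transitive discrete complexes as coset spaces *)

Section TransitiveComplex.
Local Open Scope group_scope.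
Variables (gT : finGroupType) (G : {group gT}) (X : gcomplex G).

Lemma orbit_faces_transitive (v w : vertex X) :
  faces X = orbit_faces (gact X) v -> w \in orbit (gact X) G v.
Proof. by rewrite -orbit_faces1 => <-; exact: vertex_face. Qed.

Lemma orbit_faces_eq_discrete (v : vertex X) :
  (forall w, w \in orbit (gact X) G v) ->
  orbit_faces (gact X) v = discrete_faces (vertex X).
Proof.
move=> trans_v; apply/setP=> s.
by apply/imsetP/imsetP=> -[w _ ->]; exists w; rewrite ?trans_v.
Qed.

(** Orbit-stabilizer correspondence: [w] goes to the right coset of [L] formed by the elements of
    [G] that carry [v] to [w]. *)
Lemma orbit_faces_iso (v : vertex X) (L : {group gT}) :
  faces X = orbit_faces (gact X) v -> 'C_G[v | gact X] = L ->
  gcomplex_iso X (coset_gcomplex G L).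
Proof.
move=> facesX stab_v.
have trans_v w := orbit_faces_transitive w facesX.
have am_coset w : amove (gact X) G v w \in rcosets L G.
  by rewrite -stab_v -amove_orbit ?imset_f.
pose f w : coset_point G L := Sub (amove (gact X) G v w) (am_coset w).
have f_bij : bijective f.
  exists (fun c => gact X v (repr (val c))) => [w|c]; first by rewrite amoveK.
  have Lc : val c \in rcosets 'C_G[v | gact X] G by rewrite stab_v; exact: valP c.
  by apply: val_inj; exact: (act_reprK (subxx G) Lc).
exists f; split=> // [s|w a Ga].
  rewrite /= facesX orbit_faces_eq_discrete // !discrete_facesE.
  by rewrite card_imset //; exact: bij_inj.
have /orbitP[b Gb <-] := trans_v w.
apply: val_inj; rewrite /= val_subact (fintype.subsetP (coset_point_acts G L)) //=.
by rewrite rcosetE -actMin // !amove_act ?groupM // rcosetM.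
Qed.

(** The vertex is the preimage of the trivial coset [L]: its orbit is everything, and [P] fixes it
    because [P] lies in [L]. *)
Lemma coset_iso_orbit_faces (L P : {group gT}) :
  P \subset L -> L \subset G -> gcomplex_iso X (coset_gcomplex G L) ->
  exists2 v, v \in 'Fix_(gact X)(P) & faces X = orbit_faces (gact X) v.
Proof.
move=> sPL sLG [f [f_bij f_faces f_act]].
have f_inj := bij_inj f_bij; have [g _ gK] := f_bij.
have LG : (L : {set gT}) \in rcosets L G.
  by apply/rcosetsP; exists 1; rewrite ?mulg1.
have f_act_val v a : a \in G -> val (f (gact X v a)) = val (f v) :* a.
  move=> Ga; rewrite f_act //= val_subact.
  by rewrite (fintype.subsetP (coset_point_acts G L)) //= rcosetE.
pose v := g (Sub (L : {set gT}) LG).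
have fv : val (f v) = L by rewrite gK.
have trans_v w : w \in orbit (gact X) G v.
  have /rcosetsP[a Ga def_fw] := valP (f w).
  apply/orbitP; exists a => //; apply: f_inj; apply: val_inj.
  by rewrite f_act_val // fv.
exists v; last first.
  apply/setP=> s; rewrite -f_faces orbit_faces_eq_discrete //= !discrete_facesE.
  by rewrite card_imset.
apply/afixP=> a Pa; apply: f_inj; apply: val_inj.
have La := fintype.subsetP sPL a Pa.
by rewrite f_act_val ?(fintype.subsetP sLG) // fv rcoset_id.
Qed.

Lemma card_coset_iso (L : {group gT}) :
  gcomplex_iso X (coset_gcomplex G L) -> #|vertex X| = #|G : L|.
Proof. by case=> f [/bij_eq_card -> _ _]; rewrite card_sig. Qed.

End TransitiveComplex.

Lemma gcomplex_iso_refl (gT : finGroupType) (G : {group gT}) (X : gcomplex G) :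
  gcomplex_iso X X.
Proof.
exists id; split=> // [|s]; first by exists id.
by rewrite imset_id.
Qed.

(** * Subgroups and orbits for an inverting involution *)

Section InvertingInvolution.
Local Open Scope group_scope.
Variables (gT : finGroupType) (G A C : {group gT}).
Hypotheses (G_semidirect : A ><| C = G) (A_elementary : 3.-abelem A).
Hypotheses (C_order : #|C| = 2).
Hypothesis C_inverts : forall a c : gT,
  a \in A -> c \in C -> c != 1 -> a ^ c = a^-1.

Lemma complement_Sylow2 : 2.-Sylow(G) C.
Proof.
rewrite pHallE -{1}(sdprodW G_semidirect) mulG_subr /=.
(* As [A] has odd order, the 2-part of the order of [G] is that of [C]. *)
have oddA : 2^'.-nat #|A|.
  by apply: sub_in_pnat (abelem_pgroup A_elementary) => q _ /eqP->.
rewrite -(sdprod_card G_semidirect) partnM ?cardG_gt0 // C_order.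
by rewrite (part_p'nat oddA) part_pnat_id.
Qed.

Lemma complement_sub : C \subset G.
Proof. by case/and3P: complement_Sylow2. Qed.

Lemma complement_neq1 : C :!=: 1.
Proof. by rewrite -cardG_gt1 C_order. Qed.

(** By Sylow, [P] lies in a conjugate of [C]; this has order 2, so a nontrivial [P] fills it. *)
Lemma nontrivial_2subgroup_conj (P : {group gT}) :
  P \subset G -> 2.-group P -> P :!=: 1 -> exists2 x, x \in G & P :=: C :^ x.
Proof.
move=> sPG pP ntP.
have [x Gx sPC] := Sylow_subJ complement_Sylow2 sPG pP.
exists x => //; apply/eqP; rewrite eqEcard sPC cardJg C_order.
by rewrite cardG_gt1.
Qed.

(** Every subgroup is closed under inversion. Thus [H <*> C] is the semidirect product of [H] and
    [C]. *)
Lemma complement_norm (H : {group gT}) : H \subset A -> C \subset 'N(H).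
Proof.
move=> sHA; apply/fintype.subsetP=> c Cc; rewrite inE.
apply/fintype.subsetP=> _ /imsetP[h Hh ->].
have [->|ntc] := eqVneq c 1; first by rewrite conjg1.
by rewrite C_inverts ?groupV // (fintype.subsetP sHA).
Qed.

Lemma join_complement_sub (H : {group gT}) : H \subset A -> H <*> C \subset G.
Proof.
move=> sHA; rewrite join_subG complement_sub andbT.
by rewrite (fintype.subset_trans sHA) // -(sdprodW G_semidirect) mulG_subl.
Qed.

Lemma card_join_complement (H : {group gT}) :
  H \subset A -> #|H <*> C| = (#|H| * 2)%N.
Proof.
move=> sHA; rewrite norm_joinEr ?complement_norm // -C_order TI_cardMg //.
have [_ _ _ _ tiAC] := sdprod_context G_semidirect.
by apply/eqP; rewrite -subG1 -tiAC finset.setSI.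
Qed.

(** Dedekind's modular law applied to [G = A * C] and the subgroup [C] of [S]. *)
Lemma overgroup_complement (S : {group gT}) :
  C \subset S -> S \subset G -> S = ((S :&: A) <*> C)%G.
Proof.
move=> sCS sSG; apply: group_inj; rewrite /= norm_joinEr; last first.
  by apply: complement_norm; rewrite /= finset.subsetIr.
by rewrite group_modr // (sdprodW G_semidirect) (finset.setIidPl sSG).
Qed.

Section Action.
Variables (V : finType) (to : action G V).

Lemma fixed_point_unique_in_orbit (v w : V) :
  v \in 'Fix_to(C) -> w \in orbit to G v -> w \in 'Fix_to(C) -> w = v.
Proof.
(* w = v.a for some a in A; applying the involution gives v.a = v.a^-1, so
   a^2 = a^-1 fixes v. *)
move=> /afixP fixv /orbitP[g Gg <-] /afixP fixw.
have sAG : A \subset G by rewrite -(sdprodW G_semidirect) mulG_subl.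
have [_ defG nAC _] := sdprodP G_semidirect.
have /mulsgP[c a Cc Aa def_g] : g \in C * A by rewrite (normC nAC) defG.
have [Gc Ga] := (fintype.subsetP complement_sub _ Cc, fintype.subsetP sAG _ Aa).
have {def_g Gg} va : to v g = to v a by rewrite def_g actMin // fixv.
rewrite va in fixw *.
have /trivgPn[c0 Cc0 ntc0] := complement_neq1.
have Gc0 := fintype.subsetP complement_sub _ Cc0.
have Gai : a^-1 \in G by rewrite groupV.
have va_inv : to v a = to v a^-1.
  by rewrite -(fixw _ Cc0) -actMin // conjgC C_inverts // actMin // fixv.
have a2 : a * a = a^-1.
  have [_ /(_ a Aa) a3] := abelemP (isT : prime 3) A_elementary.
  by apply/eqP; rewrite eq_sym eq_invg_mul -a3 !expgS expg0 mulg1.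
by rewrite va_inv -a2 actMin // va_inv -actMin // mulVg act1.
Qed.

(** A nontrivial 2-subgroup is some [C :^ x], whose only fixed vertex in the orbit is [to v x]; the
    stabilizer of [to v a] contains [C :^ a], of order 2. *)
Lemma orbit_faces_synthetic (R : realType) (v : V) :
  v \in 'Fix_to(C) -> synthetic_building to R 2 (orbit_faces to v).
Proof.
move=> fixv; split=> [P sPG pP ntP | _ /imsetP[_ /orbitP[a Ga <-] ->]].
  have [x Gx defP] := nontrivial_2subgroup_conj sPG pP ntP.
  apply: (@vertex_equivariantly_contractible _ _ _ _ _ _ (to v x)).
  apply/setP=> s; rewrite !inE defP; apply/andP/eqP => [[/imsetP[w vw ->]]|->].
    have Gxi : x^-1 \in G by rewrite groupV.
    (* Translating by [x^-1] reduces uniqueness for [C :^ x] to uniqueness for [C]. *)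
    rewrite finset.sub1set -{1 2}(actKVin to Gx w) afix_conj ?complement_sub //.
    move=> fixw; congr [set to _ x]; apply: fixed_point_unique_in_orbit => //.
    by rewrite orbit_actr_in.
  rewrite orbit_faces1 mem_orbit // finset.sub1set.
  by rewrite afix_conj ?complement_sub.
rewrite -C_order -(cardJg C a) cardSg //= astabs_set1.
have sCaG : C :^ a \subset G := conj_subG Ga complement_sub.
by rewrite finset.subsetI sCaG astabCin // finset.sub1set afix_conj ?complement_sub.
Qed.

End Action.

Lemma minimal_synthetic_buildingP (R : realType) (X : gcomplex G) :
  minimal_synthetic_building R 2 X <->
  exists2 v, v \in 'Fix_(gact X)(C) & faces X = orbit_faces (gact X) v.
Proof.
have pC : 2.-group C by rewrite /pgroup C_order.
split=> [[synX minX]|[v fixv facesX]].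
  have [s Xs sfix] :=
    synthetic_building_fixed_face synX complement_sub pC complement_neq1.
  have [v sv] : exists v, v \in s.
    apply/finset.set0Pn; apply: contraTneq Xs => ->.
    by have [] := facesP X.
  exists v; first exact: fintype.subsetP sfix v sv.
  (* The orbit of [v] is itself a synthetic building, so minimality forbids a proper inclusion. *)
  have /orP[/eqP-> //|propX] : (orbit_faces (gact X) v == faces X)
      || (orbit_faces (gact X) v \proper faces X).
    rewrite -subEproper acts_orbit_faces_sub ?vertex_face //.
    exact: gact_faces.
  case: (minX _ (orbit_facesP _ _) (orbit_faces_acts _ _) propX).
  by apply: orbit_faces_synthetic; exact: fintype.subsetP sfix v sv.
split=> [|D _ actsD propD synD].
  by rewrite facesX; exact: orbit_faces_synthetic.
(* A synthetic subcomplex has some face, here a vertex of the orbit; by invariance it contains the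
   whole orbit. *)
have [s Ds _] :=
  synthetic_building_fixed_face synD complement_sub pC complement_neq1.
have := fintype.subsetP (proper_sub propD) s Ds.
rewrite facesX => /imsetP[w vw def_s]; rewrite def_s in Ds.
case/negP: (proper_subn propD); rewrite facesX.
apply: fintype.subset_trans (acts_orbit_faces_sub actsD Ds).
apply/fintype.subsetP=> _ /imsetP[u vu ->]; rewrite orbit_faces1.
by rewrite (orbit_in_transl _ (subxx G) vu) orbit_in_sym.
Qed.

Lemma minimal_synthetic_building_coset (R : realType) (X : gcomplex G) :
  minimal_synthetic_building R 2 X <->
  exists2 H : {group gT}, H \subset A
    & gcomplex_iso X (coset_gcomplex G (H <*> C)%G).
Proof.
split=> [/minimal_synthetic_buildingP[v fixv facesX]|[H sHA isoX]].
  (* The stabilizer of [v] contains [C], so it is recovered from its intersection with [A]. *)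
  exists ('C_G[v | gact X] :&: A)%G; first by rewrite /= finset.subsetIr.
  apply: orbit_faces_iso facesX _.
  rewrite -overgroup_complement ?finset.subsetIl //=.
  by rewrite finset.subsetI complement_sub astabCin ?complement_sub // finset.sub1set.
apply/minimal_synthetic_buildingP; apply: coset_iso_orbit_faces isoX.
  exact: joing_subr.
exact: join_complement_sub.
Qed.

End InvertingInvolution.

(** * Classification and count of homotopy types *)

Theorem theorem5p5 (R : realType) (d : nat)
    (gT : finGroupType) (G A C : {group gT})
    (G_semidirect : (A ><| C)%g = G)
    (A_elementary : (3.-abelem A)%g) (A_order : #|A| = (3 ^ d)%N)
    (C_order : #|C| = 2%N)
    (C_inverts : forall a c : gT, a \in A -> c \in C -> c != 1%g ->
      (a ^ c = a^-1)%g) :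
  (forall X : gcomplex G,
     minimal_synthetic_building R 2 X <->
     exists2 H : {group gT}, H \subset A
       & gcomplex_iso X (coset_gcomplex G (H <*> C)%G))
  /\
  exists B : 'I_d.+1 -> gcomplex G,
    [/\ forall i, minimal_synthetic_building R 2 (B i),
        forall i j, same_homotopy_type R (B i) (B j) -> i = j
      & forall X : gcomplex G, minimal_synthetic_building R 2 X ->
          exists i, same_homotopy_type R X (B i)].
Proof.
have minP X := minimal_synthetic_building_coset
  G_semidirect A_elementary C_order C_inverts R X.
split=> //.
have [pA _] := andP A_elementary.
have nAA : (A <| A)%g by exact: normal_refl.
(* The 3-group [A] has a subgroup of each order [3 ^ i] with [i <= d]; one choice for each [i] gives
   the representatives. *)
have subgroup_of_order (i : 'I_d.+1) :
    exists H : {group gT}, H \subset A /\ #|H| = (3 ^ i)%N.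
  have [|H [sHA _ oH]] := normal_pgroup (r := i) pA nAA; last by exists H.
  by rewrite A_order pfactorK // -ltnS.
have [H HP] := fin_all_exists subgroup_of_order.
pose B i := coset_gcomplex G (H i <*> C)%G.
have card_B i : (#|vertex (B i)| * (3 ^ i * 2))%N = #|G|.
  have [sHA oH] := HP i; rewrite -oH -(card_join_complement G_semidirect C_order C_inverts) //.
  rewrite (card_coset_iso (gcomplex_iso_refl (B i))) mulnC Lagrange //.
  exact: (join_complement_sub G_semidirect A_elementary).
exists B; split=> [i|i j Bij|X minX].
- by apply/minP; exists (H i); [case: (HP i) | exact: gcomplex_iso_refl].
- have le_ij := discrete_homotopy_card erefl erefl Bij.
  have le_ji := discrete_homotopy_card erefl erefl (homotopy_equivalent_sym Bij).
  have eq_ij : #|vertex (B i)| = #|vertex (B j)|.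
    by apply/eqP; rewrite eqn_leq le_ij.
  (* With equal vertex counts, cancelling in the two expressions for the order of [G] leaves
     [3 ^ i = 3 ^ j]. *)
  apply: val_inj; apply: (@expnI 3) => //; apply/eqP.
  have B_gt0 : (0 < #|vertex (B j)| * 2)%N.
    by have := cardG_gt0 G; rewrite -(card_B j) !muln_gt0 => /andP[-> _].
  have := card_B i; rewrite -(card_B j) eq_ij !(mulnC (3 ^ _)) !mulnA => /eqP.
  by rewrite eqn_pmul2l.
have /minP[L sLA isoX] := minX.
have /(minimal_synthetic_buildingP G_semidirect A_elementary C_order C_inverts)[v _ facesX] := minX.
(* The order of [L] divides [3 ^ d]; its exponent [k] selects the representative with as many
   vertices as [X]. *)
have [k le_kd oL] : exists2 k, (k <= d)%N & #|L| = (3 ^ k)%N.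
  by apply/dvdn_pfactor; rewrite // -A_order cardSg.
exists (inord k); apply: discrete_homotopy_equivalent => //.
  by rewrite facesX; apply: orbit_faces_eq_discrete => w; exact: orbit_faces_transitive.
have L_gt0 : (0 < 3 ^ k * 2)%N by rewrite muln_gt0 expn_gt0.
apply/eqP; rewrite -(eqn_pmul2r L_gt0).
have := card_B (inord k); rewrite inordK // => ->; rewrite (card_coset_iso isoX) -oL.
rewrite -(card_join_complement G_semidirect C_order C_inverts sLA) mulnC Lagrange //.
exact: (join_complement_sub G_semidirect A_elementary).
Qed.
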